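(* Let $p>7$ be a prime. Then $$\sum_{k=0}^{[p/8]}\binom{[\frac p8]}k\binom{[\frac{3p}8]}k\Big(-\frac{16}9\Big)^k\equiv\begin{cases}2A\pmod p&\text{if }p=A^2+3B^2\equiv1,19\pmod{24},\ 3\mid A-1,\\ -\frac65A\pmod p&\text{if }p=A^2+3B^2\equiv7,13\pmod{24},\ 3\mid A-1,\\0\pmod p&\text{if }p\equiv2\pmod3,\end{cases}$$ where $A,B\in\mathbb Z$.
   Context: $[x]$ is the floor; congruences mod $p$ are among rationals with denominator coprime to $p$. *)

(* Defs.v *)
From mathcomp Require Import all_boot all_order all_algebra.

Set Implicit Arguments.
Unset Strict Implicit.
Unset Printing Implicit Defensive.

Import GRing.Theory Num.Theory.
Local Open Scope ring_scope.

(* x = y (mod m) in the ring of rationals whose denominator is coprime to m;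
   membership of both sides in that ring is part of the relation. *)
Definition rat_eqmod (m : nat) (x y : rat) : Prop :=
  [/\ coprimez m (denq x), coprimez m (denq y) & (m %| numq (x - y))%Z].

(* Main.v *)
Require Import Defs.
From mathcomp Require Import all_boot all_order all_algebra.
From mathcomp Require Import all_solvable all_field.
From mathcomp Require Import zify ring.

Set Implicit Arguments.
Unset Strict Implicit.
Unset Printing Implicit Defensive.

Import Order.TTheory GRing.Theory Num.Theory.
Local Open Scope ring_scope.

(* Write m = (p - 1)/2, let S be the sum of the theorem, and compute in F_p.
   With 1 - 2x = -5/3 at x = 4/3, the quadratic transformations
     2F1(1/8,3/8;1;4x(1-x)) = 2F1(1/4,3/4;1;x)
     (1-2x) 2F1(5/8,7/8;1;4x(1-x)) = 2F1(1/4,3/4;1;x)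
   turn S (p = 1, 3 mod 8), respectively -(5/3) S (p = 5, 7 mod 8), into
   Q(4/3) = sum_k C(m,2k) C(2k,k) 3^(-k).  They hold as identities of truncated
   polynomials because both sides satisfy the same second-order differential
   equation and have degree < p.
   Next, 3^m Q(4/3) is the coefficient of X^m in (X^2+3X+3)^m, that is the
   coefficient of X^(p-1) in ((X+1)^3-1)^m, which equals - sum_x (x^3-1)^m.
   If p = 2 mod 3 cubing is bijective and the sum vanishes.  If p = 1 mod 3 it is
   a Jacobsthal sum: let s_i = chi(g^i) sum_x chi(x^3+g^i) (i = 0, 1, 2) with g a
   primitive root.  Then s_0 + s_1 + s_2 = 0 and s_0^2 + s_1^2 + s_2^2 = 6p, so
   that 4p = s_0^2 + 3 M^2; as s_0 is even and = 1 mod 3, s_0 = -2A. *)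

(** * Quadratic transformations *)

(* The operator annihilating 2F1(a,b;1;X), where s = a + b and r = a b. *)
Definition hyp_op (R : comNzRingType) (s r : R) (P : {poly R}) : {poly R} :=
  'X * (1 - 'X) * P^`()^`() + (1 - (s%:P + 1) * 'X) * P^`() - r%:P * P.

(** As [k^2 + s k + r = (k + a)(k + b)], the differential equation amounts to the two-term
    recurrence of hypergeometric coefficients. *)
Lemma coef_hyp_op (R : comNzRingType) (s r : R) (P : {poly R}) (k : nat) :
  (hyp_op s r P)`_k =
  k.+1%:R ^+ 2 * P`_k.+1 - (k%:R ^+ 2 + s * k%:R + r) * P`_k.
Proof.
have -> : hyp_op s r P = 'X * (P^`()^`() - 'X * P^`()^`()) + P^`()
    - s%:P * ('X * P^`()) - 'X * P^`() - r%:P * P.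
  by rewrite /hyp_op; ring.
rewrite !(coefB, coefD, coefN, coefXM, coefCM, coef_deriv).
case: k => [|[|k]] /=.
- by rewrite mulr1n; ring.
- by rewrite mulr1n; ring.
- by ring.
Qed.

Lemma comp_hyp_op (R : comNzRingType) (s r : R) (P z : {poly R}) :
  hyp_op s r P \Po z =
  z * (1 - z) * (P^`()^`() \Po z) + (1 - (s%:P + 1) * z) * (P^`() \Po z)
  - r%:P * (P \Po z).
Proof.
by rewrite /hyp_op !(comp_polyB, comp_polyD, comp_polyM, comp_polyC, comp_polyX,
  comp_polyC 1).
Qed.

(** Differential form of 2F1(a,b;1;z) = 2F1(2a,2b;1;x) for a + b = 1/2 and z = 4x(1-x); it rests on
    z'^2 = 16(1-z) and z'' = -8. *)
Lemma hyp_op_quadratic_even (R : comNzRingType) (s r : R) (P : {poly R}) :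
  2%:R * s = 1 -> hyp_op s r P = 0 ->
  hyp_op 1 (4%:R * r) (P \Po ('X * (1 - 'X) *+ 4)) = 0.
Proof.
move=> Hs HP; set z := ('X * (1 - 'X) *+ 4).
have Hs' : 2%:R * s%:P - 1 = 0 :> {poly R}.
  by rewrite -(rmorph_nat polyC) -rmorphM /= Hs subrr.
have dz : z^`() = 4%:R - 8%:R * 'X.
  by rewrite /z !(derivM, derivB, derivX, derivMn, derivC 1); ring.
have := comp_hyp_op s r P z; rewrite HP comp_poly0 => H.
rewrite /hyp_op !(deriv_comp, derivM, dz, derivB, derivX, derivC, derivMn).
rewrite rmorphM /= rmorph_nat.
rewrite polyC1; set P0 := P \Po z in H *.
set P2 := _ \Po z in H *; set P1 := _ \Po z in H *.
set H0 := (X in _ = X) in H.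
(* The new equation is 4 times the pulled-back one plus a multiple of 2s - 1. *)
transitivity (4%:R * H0 + 2%:R * z * P1 * (2%:R * s%:P - 1)).
  by rewrite /H0 /z; ring.
by rewrite -H Hs' !mulr0 addr0.
Qed.

(** For a + b = 3/2, Euler's transformation and 1 - z = (1-2x)^2 give (1-2x) 2F1(a,b;1;z) =
    2F1(1-a,1-b;1;z), which reduces to the even case; the new parameter is 4(1-a)(1-b) = 4r - 2. The
    equation is checked directly. *)
Lemma hyp_op_quadratic_odd (R : comNzRingType) (s r : R) (P : {poly R}) :
  2%:R * s = 3%:R -> hyp_op s r P = 0 ->
  hyp_op 1 (4%:R * r - 2%:R) ((1 - 'X *+ 2) * (P \Po ('X * (1 - 'X) *+ 4))) = 0.
Proof.
move=> Hs HP; set z := ('X * (1 - 'X) *+ 4).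
have Hs' : 2%:R * s%:P - 3%:R = 0 :> {poly R}.
  by rewrite -!(rmorph_nat polyC) -rmorphM /= Hs subrr.
have dz : z^`() = 4%:R - 8%:R * 'X.
  by rewrite /z !(derivM, derivB, derivX, derivMn, derivC 1); ring.
have := comp_hyp_op s r P z; rewrite HP comp_poly0 => H.
rewrite /hyp_op !(deriv_comp, derivM, dz, derivB, derivD, derivX, derivC, derivMn).
rewrite rmorphB rmorphM /= !rmorph_nat.
rewrite polyC1; set P0 := P \Po z in H *.
set P2 := _ \Po z in H *; set P1 := _ \Po z in H *.
set H0 := (X in _ = X) in H.
transitivity ((1 - 'X *+ 2) * (4%:R * H0 + 2%:R * z * P1 * (2%:R * s%:P - 3%:R))).
  by rewrite /H0 /z; ring.
by rewrite -H Hs' !mulr0 addr0 mulr0.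
Qed.

(** The recurrence determines coefficient k+1 from coefficient k as long as k+1 is invertible, that
    is below p; the size bounds kill all later coefficients. *)
Lemma hyp_op_uniq (F : fieldType) (p : nat) (s r : F) (P Q : {poly F}) :
  p \in [pchar F] -> (size P <= p)%N -> (size Q <= p)%N ->
  hyp_op s r P = 0 -> hyp_op s r Q = 0 -> P`_0 = Q`_0 -> P = Q.
Proof.
move=> charFp sP sQ HP HQ H0; apply/polyP.
elim=> [//|k IHk].
have [kp|pk] := ltnP k.+1 p; last first.
  by rewrite !nth_default // (leq_trans _ pk).
have k_neq0 : k.+1%:R ^+ 2 != 0 :> F.
  by rewrite expf_eq0 /= -(dvdn_pcharf charFp) gtnNdvd.
have := coef_hyp_op s r P k; have := coef_hyp_op s r Q k.
rewrite HP HQ !coef0 => /esym/subr0_eq HQk /esym/subr0_eq HPk.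
by apply: (mulfI k_neq0); rewrite HPk HQk IHk.
Qed.

Lemma mulr_bin_left (R : pzRingType) (n k : nat) :
  k.+1%:R * 'C(n, k.+1)%:R = (n%:R - k%:R) * 'C(n, k)%:R :> R.
Proof.
have [le_kn|lt_nk] := leqP k n.
  by rewrite -natrM mul_bin_left natrM natrB.
by rewrite !bin_small ?mulr0 // ltnW.
Qed.

(** This is 2F1(-n1,-n2;1;X), a polynomial because the series terminates. *)
Definition bin2_poly (R : nzRingType) (n1 n2 : nat) : {poly R} :=
  \poly_(k < n1.+1) ('C(n1, k)%:R * 'C(n2, k)%:R).

Lemma hyp_op_bin2_poly (R : comNzRingType) (n1 n2 : nat) :
  hyp_op (- (n1%:R + n2%:R)) (n1%:R * n2%:R) (bin2_poly R n1 n2) = 0.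
Proof.
have coefP k : (bin2_poly R n1 n2)`_k = 'C(n1, k)%:R * 'C(n2, k)%:R.
  by rewrite coef_poly ltnS; case: leqP => // /bin_small ->; rewrite mul0r.
apply/polyP => k; rewrite coef_hyp_op !coefP coef0.
transitivity ((k.+1%:R * 'C(n1, k.+1)%:R) * (k.+1%:R * 'C(n2, k.+1)%:R)
  - (k%:R ^+ 2 + - (n1%:R + n2%:R) * k%:R + n1%:R * n2%:R)
    * ('C(n1, k)%:R * 'C(n2, k)%:R) : R); first by ring.
by rewrite !mulr_bin_left; ring.
Qed.

(* With u = 1/4 and m = -1/2 this is the truncation of 2F1(1/4,3/4;1;X). *)
Definition trinomial_poly (R : nzRingType) (u : R) (m : nat) : {poly R} :=
  \poly_(k < m.+1) ('C(m, k.*2)%:R * 'C(k.*2, k)%:R * u ^+ k).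

Lemma coef_trinomial_poly (R : nzRingType) (u : R) (m k : nat) :
  (trinomial_poly u m)`_k = 'C(m, k.*2)%:R * 'C(k.*2, k)%:R * u ^+ k.
Proof.
rewrite coef_poly ltnS; case: leqP => // lt_mk.
by rewrite bin_small ?mul0r //; lia.
Qed.

Lemma mul_bin_central (k : nat) :
  (k.+1 ^ 2 * 'C(k.+1.*2, k.+1) = k.+1.*2 * k.*2.+1 * 'C(k.*2, k))%N.
Proof.
have e1 := mul_bin_diag k.+1.*2 k; have e2 := mul_bin_down k.*2.+1 k.
move: e1 e2; rewrite doubleS /= (_ : k.*2.+1 - k = k.+1)%N; last by lia.
by move=> e1 e2; rewrite -mulnA e2 mulnCA e1 mulnA.
Qed.

(** Consecutive coefficients have ratio u(m-2k)(m-2k-1)/(k+1)^2, which for u = 1/4 and m = -1/2 is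
    (k+1/4)(k+3/4)/(k+1)^2. *)
Lemma hyp_op_trinomial_poly (R : comNzRingType) (u : R) (m : nat) :
  4%:R * u = 1 -> m%:R = - (2%:R * u) ->
  hyp_op 1 (3%:R * u ^+ 2) (trinomial_poly u m) = 0.
Proof.
move=> u4 mu; apply/polyP => k; rewrite coef_hyp_op !coef_trinomial_poly coef0.
rewrite (exprS u k).
have e1 : k.+1%:R ^+ 2 * 'C(k.+1.*2, k.+1)%:R
    = k.+1.*2%:R * k.*2.+1%:R * 'C(k.*2, k)%:R :> R.
  by rewrite -natrX -!natrM mul_bin_central.
have e2 := mulr_bin_left R m k.*2.+1; have e3 := mulr_bin_left R m k.*2.
transitivity (u * u ^+ k * 'C(m, k.+1.*2)%:R * (k.+1%:R ^+ 2 * 'C(k.+1.*2, k.+1)%:R)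
  - (k%:R ^+ 2 + 1 * k%:R + 3%:R * u ^+ 2) * ('C(m, k.*2)%:R * 'C(k.*2, k)%:R * u ^+ k)).
  set c1 := 'C(m, k.+1.*2)%:R; set c2 := 'C(_, k.+1)%:R.
  by ring.
rewrite e1.
transitivity (u * u ^+ k * 'C(k.*2, k)%:R * (k.*2.+1%:R * (k.*2.+2%:R * 'C(m, k.*2.+2)%:R))
  - (k%:R ^+ 2 + 1 * k%:R + 3%:R * u ^+ 2) * ('C(m, k.*2)%:R * 'C(k.*2, k)%:R * u ^+ k)).
  by rewrite doubleS; ring.
rewrite e2 (mulrCA k.*2.+1%:R) e3 mu.
have -> : k.*2%:R = 2%:R * k%:R :> R by rewrite -mul2n natrM.
(* Writing 1 as 4u makes every factor homogeneous in k and u, so that (k+u)(k+3u) splits off. *)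
have -> : k.*2.+1%:R = 2%:R * k%:R + 4%:R * u :> R.
  by rewrite -natr1 -mul2n natrM u4.
transitivity (u ^+ k * 'C(k.*2, k)%:R * 'C(m, k.*2)%:R *
  ((k%:R + u) * (k%:R + 3%:R * u) * (4%:R * u) - (k%:R ^+ 2 + 1 * k%:R + 3%:R * u ^+ 2))).
  by ring.
have -> : k%:R ^+ 2 + 1 * k%:R + 3%:R * u ^+ 2 = (k%:R + u) * (k%:R + 3%:R * u).
  by transitivity (k%:R ^+ 2 + 4%:R * u * k%:R + 3%:R * u ^+ 2); [rewrite u4 | ring].
by rewrite u4 mulr1 subrr mulr0.
Qed.

Lemma size_bin2_poly (R : nzRingType) (n1 n2 : nat) :
  (size (bin2_poly R n1 n2) <= n1.+1)%N.
Proof. exact: size_poly. Qed.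

Lemma size_comp_quadratic (R : nzRingType) (n : nat) (P : {poly R}) :
  (size P <= n.+1)%N -> (size (P \Po ('X * (1 - 'X) *+ 4)) <= n.*2.+1)%N.
Proof.
move=> sP; apply: leq_trans (size_comp_poly_leq _ _) _.
rewrite ltnS -muln2 leq_mul //; first by case: (size P) sP.
suff: (size ('X * (1 - 'X) *+ 4 : {poly R})%R <= 3)%N by case: (size _).
rewrite -scaler_nat; apply: leq_trans (size_scale_leq _ _) _.
apply: leq_trans (size_polyMleq _ _) _; rewrite size_polyX /=.
rewrite ltnS (leq_trans (size_polyD _ _)) //.
by rewrite size_polyN size_polyX size_poly1.
Qed.

(** The hypotheses say that -n1 and -n2 are 1/8 and 3/8 in F, in some order. Both polynomials then
    solve the equation of 2F1(1/4,3/4;1;X), have degree below p and constant term 1. *)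
Lemma bin2_trinomial_even (F : fieldType) (p n1 n2 m : nat) (u x : F) :
  p \in [pchar F] -> (n1.*2 < p)%N -> (m < p)%N ->
  4%:R * u = 1 -> m%:R = - (2%:R * u) ->
  2%:R * (n1%:R + n2%:R) = -1 :> F -> 4%:R * (n1%:R * n2%:R) = 3%:R * u ^+ 2 ->
  (bin2_poly F n1 n2).[4%:R * (x * (1 - x))] = (trinomial_poly u m).[x].
Proof.
move=> charFp n1p mp u4 mu s2 r4; set z : {poly F} := 'X * (1 - 'X) *+ 4.
have zx y : z.[y] = 4%:R * (y * (1 - y)).
  by rewrite /z hornerMn hornerM hornerD hornerN hornerX hornerC mulr_natl.
rewrite -zx -horner_comp; congr (_.[x]).
apply: (hyp_op_uniq charFp _ _ _ (hyp_op_trinomial_poly u4 mu)).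
- exact: leq_trans (size_comp_quadratic (size_bin2_poly _ _ _)) n1p.
- by apply: leq_trans (size_poly _ _) _.
- rewrite -r4; apply: hyp_op_quadratic_even; last exact: hyp_op_bin2_poly.
  by rewrite mulrN s2 opprK.
- rewrite coef_trinomial_poly -horner_coef0 horner_comp zx mul0r mulr0.
  by rewrite horner_coef0 coef_poly !bin0 expr0 !mulr1.
Qed.

(** Same argument with -n1 and -n2 equal to 5/8 and 7/8; the factor 1 - 2x raises the degree to at
    most 2 n1 + 1. *)
Lemma bin2_trinomial_odd (F : fieldType) (p n1 n2 m : nat) (u x : F) :
  p \in [pchar F] -> (n1.*2.+1 < p)%N -> (m < p)%N ->
  4%:R * u = 1 -> m%:R = - (2%:R * u) ->
  2%:R * (n1%:R + n2%:R) = - 3%:R :> F ->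
  4%:R * (n1%:R * n2%:R) - 2%:R = 3%:R * u ^+ 2 ->
  (1 - 2%:R * x) * (bin2_poly F n1 n2).[4%:R * (x * (1 - x))]
  = (trinomial_poly u m).[x].
Proof.
move=> charFp n1p mp u4 mu s2 r4; set z : {poly F} := 'X * (1 - 'X) *+ 4.
have zx y : z.[y] = 4%:R * (y * (1 - y)).
  by rewrite /z hornerMn hornerM hornerD hornerN hornerX hornerC mulr_natl.
have lx y : (1 - 'X *+ 2 : {poly F}).[y] = 1 - 2%:R * y.
  by rewrite hornerD hornerN hornerMn hornerX hornerC mulr_natl.
rewrite -zx -horner_comp -lx -hornerM; congr (_.[x]).
apply: (hyp_op_uniq charFp _ _ _ (hyp_op_trinomial_poly u4 mu)).
- apply: leq_trans (size_polyMleq _ _) _.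
  have := size_comp_quadratic (size_bin2_poly F n1 n2).
  have : (size (1 - 'X *+ 2 : {poly F})%R <= 2)%N.
    rewrite (leq_trans (size_polyD _ _)) // size_polyN size_poly1 -scaler_nat.
    by rewrite geq_max /= (leq_trans (size_scale_leq _ _)) ?size_polyX.
  move=> le1 le2; rewrite -subn1 leq_subLR.
  by apply: leq_trans (leq_add le1 le2) _; rewrite add1n add2n ltnS.
- by apply: leq_trans (size_poly _ _) _.
- rewrite -r4; apply: hyp_op_quadratic_odd; last exact: hyp_op_bin2_poly.
  by rewrite mulrN s2 opprK.
- rewrite coef_trinomial_poly -horner_coef0 hornerM horner_comp zx lx.
  by rewrite mul0r !mulr0 subr0 mul1r horner_coef0 coef_poly !bin0 expr0 !mulr1.
Qed.

(** * Power sums over a finite field *)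

(** X^m arises by picking X^2 from k factors, b from k others and aX from the remaining m - 2k. *)
Lemma coef_central_trinomial (R : comNzRingType) (a b : R) (m : nat) :
  ((('X^2 + b%:P) + a%:P * 'X) ^+ m)`_m =
  \sum_(k < m.+1) 'C(m, k.*2)%:R * 'C(k.*2, k)%:R * (a ^+ (m - k.*2) * b ^+ k).
Proof.
pose G i k : R := 'C(m, i)%:R * 'C(i, k)%:R * (a ^+ (m - i) * b ^+ k).
have coefXb i : (i < m.+1)%N -> (('X^2 + b%:P) ^+ i)`_i =
    \sum_(k < m.+1 | k.*2 == i) 'C(i, k)%:R * b ^+ k :> R.
  rewrite addrC exprDn coef_sum.
  move=> le_im; transitivity (\sum_(k < i.+1 | k.*2 == i) 'C(i, k)%:R * b ^+ k).
    rewrite [RHS]big_mkcond /=; apply: eq_bigr => k _.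
    rewrite coefMn -rmorphXn /= coefCM -exprM coefXn mul2n eq_sym.
    case: eqP => [ik|_]; last by rewrite mulr0 mul0rn.
    by rewrite (_ : i - k = k :> nat)%N; [rewrite mulr1 mulr_natl | lia].
  have -> := @big_ord_widen_cond R 0 +%R _ _ (fun k => k.*2 == i)
    (fun k => 'C(i, k)%:R * b ^+ k) le_im.
  by apply: eq_bigl => k /=; case: eqP => //= <-; lia.
rewrite addrC exprDn coef_sum.
transitivity (\sum_(i < m.+1) \sum_(k < m.+1 | k.*2 == i) G i k).
  apply: eq_bigr => i _; rewrite coefMn exprMn -rmorphXn /= -mulrA coefCM.
  rewrite coefXnM ltnNge leq_subr /= (@subKn i m (ltn_ord i)) (coefXb _ (ltn_ord i)).
  rewrite mulr_sumr -sumrMnl; apply: eq_bigr => k _.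
  by rewrite /G -mulr_natl; ring.
rewrite (exchange_big_dep predT) //=; apply: eq_bigr => k _.
rewrite (eq_bigl (fun i : 'I_m.+1 => i == k.*2 :> nat)) => [|i]; last exact: eq_sym.
(* If 2k > m no index i is left, and the binomial coefficient vanishes too. *)
rewrite (big_ord1_eq _ (G^~ k : nat -> R)) ltnS; case: leqP => // lt_mk.
by rewrite bin_small ?mul0r.
Qed.

Lemma expf_card_pred (F : finFieldType) (x : F) : x != 0 -> x ^+ #|F|.-1 = 1.
Proof.
move=> x_neq0; apply: (mulfI x_neq0).
by rewrite -exprS prednK ?expf_card ?mulr1 // ltnW ?finNzRing_gt1.
Qed.

Lemma finField_prim_root (F : finFieldType) :
  exists g : F, (#|F|.-1).-primitive_root g.
Proof.
have q_gt0 : (0 < #|F|.-1)%N by rewrite -subn1 subn_gt0 finNzRing_gt1.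
have := @has_prim_root F #|F|.-1 (enum (predC1 (0 : F))) q_gt0.
case/(_ _ _ _)/hasP => [|||g _ gP]; last by exists g.
- apply/allP => x; rewrite mem_enum inE unity_rootE => x_neq0.
  by rewrite expf_card_pred.
- exact: enum_uniq.
- by rewrite -cardE cardC1.
Qed.

(** Scaling the variable by a primitive root g multiplies the sum by g^n, which differs from 1. *)
Lemma sum_expr_finField (F : finFieldType) (n : nat) :
  ~~ (#|F|.-1 %| n)%N -> \sum_(x : F) x ^+ n = 0.
Proof.
move=> ndvd; have [g gP] := finField_prim_root F.
have g_neq0 : g != 0.
  by rewrite (prim_root_eq0 gP) -lt0n (prim_order_gt0 gP).
have gn : g ^+ n != 1 by rewrite -(prim_order_dvd gP).
have : \sum_(x : F) x ^+ n = g ^+ n * \sum_(x : F) x ^+ n.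
  rewrite {1}(reindex_inj (mulfI g_neq0)) mulr_sumr.
  by apply: eq_bigr => x _; rewrite exprMn.
move/eqP; rewrite -subr_eq0 -{1}[X in X - _]mul1r -mulrBl mulf_eq0 subr_eq0 eq_sym.
by rewrite (negPf gn) => /eqP.
Qed.

(** Among the exponents below 2(p-1), only p-1 has a nonzero power sum, namely -1; exponent 0 gives
    p = 0. *)
Lemma sum_horner_finField (p : nat) (F : finFieldType) (f : {poly F}) :
  p \in [pchar F] -> #|F| = p -> (size f <= p.-1.*2)%N ->
  \sum_(x : F) f.[x] = - f`_p.-1.
Proof.
move=> charFp cardF sf.
have p_gt1 : (1 < p)%N by rewrite -cardF finNzRing_gt1.
have sum1 : \sum_(x : F) 1 = 0 :> F.
  by rewrite sumr_const cardF (pcharf0 charFp).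
have sumq : \sum_(x : F) x ^+ p.-1 = -1.
  have : \sum_(x : F) (x ^+ p.-1 - 1) = -1.
    rewrite (bigD1 0) //= big1 => [|x x_neq0]; last first.
      by rewrite -cardF expf_card_pred ?subrr.
    by rewrite expr0n -subn1 subn_eq0 leqNgt p_gt1 addr0 sub0r.
  by rewrite sumrB sum1 subr0.
transitivity (\sum_(i < p.-1.*2) f`_i * \sum_(x : F) x ^+ i).
  under eq_bigr => x _ do rewrite (horner_coef_wide _ sf).
  by rewrite exchange_big /=; apply: eq_bigr => i _; rewrite mulr_sumr.
have lt_p : (p.-1 < p.-1.*2)%N by lia.
rewrite (bigD1 (Ordinal lt_p)) //= sumq mulrN1 big1 ?addr0 // => i i_neq.
have [i0|i_gt0] := posnP i; first by rewrite i0 (eq_bigr (fun=> 1)) ?sum1 ?mulr0.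
rewrite sum_expr_finField ?mulr0 // cardF; apply/negP => /dvdnP[c ic].
have := ltn_ord i; move: i_neq; rewrite -val_eqE /= => /eqP.
by case: c ic => [|[|c]]; rewrite ?mulSn ?mul0n => ic; lia.
Qed.

(** The translation x -> 1 + x turns x^3 - 1 into x(x^2 + 3x + 3). As p - 1 = 2m, the power sum is
    minus the coefficient of X^m in (X^2 + 3X + 3)^m. *)
Lemma trinomial_power_sum (p m : nat) (F : finFieldType) (u v : F) :
  p \in [pchar F] -> #|F| = p -> p = m.*2.+1 -> 4%:R * u = 1 -> 3%:R * v = 1 ->
  3%:R ^+ m * (trinomial_poly u m).[4%:R * v] = - \sum_(x : F) (x ^+ 3 - 1) ^+ m.
Proof.
move=> charFp cardF pm u4 v3.
have m_gt0 : (0 < m)%N.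
  by have := finNzRing_gt1 F; rewrite cardF pm; case: (m).
pose g : {poly F} := ('X^2 + 3%:R%:P) + 3%:R%:P * 'X.
have -> : \sum_(x : F) (x ^+ 3 - 1) ^+ m = \sum_(x : F) (g ^+ m * 'X^m).[x].
  rewrite (reindex_inj (addrI (1 : F))) /=; apply: eq_bigr => x _.
  rewrite hornerM !horner_exp hornerX -exprMn; congr (_ ^+ m).
  by rewrite /g !hornerD !hornerM !hornerX !hornerC; ring.
rewrite (@sum_horner_finField p F (g ^+ m * 'X^m) charFp cardF) ?opprK.
  rewrite pm /= coefMXn ltnNge -addnn leq_addl /= addnK coef_central_trinomial.
  rewrite horner_poly mulr_sumr; apply: eq_bigr => k _.
  have [le_km|lt_mk] := leqP k.*2 m; last by rewrite (bin_small lt_mk) !mul0r mulr0.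
  have -> : 3%:R ^+ (m - k.*2) * 3%:R ^+ k = 3%:R ^+ m * v ^+ k :> F.
    have -> : 3%:R ^+ m = 3%:R ^+ (m - k.*2) * 3%:R ^+ k * 3%:R ^+ k :> F.
      by rewrite -!exprD; congr (_ ^+ _); lia.
    by rewrite -[RHS]mulrA -exprMn v3 expr1n mulr1.
  have -> : v ^+ k = u ^+ k * (4%:R * v) ^+ k.
    by rewrite -exprMn mulrA (mulrC u) u4 mul1r.
  by ring.
apply: leq_trans (size_polyMleq _ _) _; rewrite size_polyXn addnS /= pm /=.
have sg : (size g <= 3)%N.
  rewrite /g (leq_trans (size_polyD _ _)) // geq_max.
  rewrite (leq_trans (size_polyD _ _)) ?size_polyXn ?geq_max
    ?(leq_trans (size_polyC_leq1 _)) //=.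
  apply: leq_trans (size_polyMleq _ _) _; rewrite size_polyX addn2 /=.
  by rewrite ltnS (leq_trans (size_polyC_leq1 _)).
have sgm : (size (g ^+ m) <= (2 * m).+1)%N.
  apply: leq_trans (size_poly_exp_leq _ _) _.
  by rewrite ltnS leq_mul2r; apply/orP; right; case: (size g) sg.
(* The degree is at most 3m, and 3m + 1 <= 4m = 2(p-1) because m > 0. *)
by apply: leq_trans (leq_add sgm (leqnn m)) _; lia.
Qed.

(** * The quadratic character and cubic Jacobsthal sums *)

(* This is the quadratic character only when #|F| is odd. *)
Definition qchar (F : finFieldType) (x : F) : int :=
  if x == 0 then 0 else if x ^+ (#|F|./2) == 1 then 1 else -1.

Lemma qchar0 (F : finFieldType) : qchar (0 : F) = 0.
Proof. by rewrite /qchar eqxx. Qed.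

Lemma qchar1 (F : finFieldType) : qchar (1 : F) = 1.
Proof. by rewrite /qchar oner_eq0 expr1n eqxx. Qed.

Lemma sqr_qchar (F : finFieldType) (x : F) : qchar x ^+ 2 = (x != 0)%:R.
Proof. by rewrite /qchar; case: (x == 0) => //; case: (_ == 1). Qed.

Lemma card_pred_half (F : finFieldType) :
  odd #|F| -> #|F|.-1 = (#|F|./2 * 2)%N.
Proof. by move=> oddF; rewrite -{1}(odd_double_half #|F|) oddF muln2. Qed.

Lemma half_card_gt0 (F : finFieldType) : (0 < #|F|./2)%N.
Proof. by have := finNzRing_gt1 F; case: #|F| => [|[|n]]. Qed.

Lemma expf_half_card (F : finFieldType) (x : F) :
  odd #|F| -> x != 0 -> x ^+ (#|F|./2) != 1 -> x ^+ (#|F|./2) = -1.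
Proof.
move=> oddF x_neq0 /negPf xm; apply/eqP; move: (expf_card_pred x_neq0).
by rewrite card_pred_half // exprM => /eqP; rewrite sqrf_eq1 xm.
Qed.

Lemma nonresidue_finField (F : finFieldType) :
  odd #|F| -> exists2 g : F, g != 0 & g ^+ (#|F|./2) != 1.
Proof.
move=> oddF; have [g gP] := finField_prim_root F; exists g.
  by rewrite (prim_root_eq0 gP) -lt0n (prim_order_gt0 gP).
rewrite -(prim_order_dvd gP) card_pred_half // gtnNdvd ?half_card_gt0 //.
by rewrite muln2 -addnn -[X in (X < _)%N]addn0 ltn_add2l half_card_gt0.
Qed.

(** The half power of a nonresidue is -1, yet differs from 1. *)
Lemma eqN11_finField (F : finFieldType) : odd #|F| -> (-1 == 1 :> F) = false.
Proof.
move=> oddF; have [g g_neq0 gm] := nonresidue_finField oddF.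
by rewrite -(expf_half_card oddF g_neq0 gm) (negPf gm).
Qed.

Lemma intr_qchar (F : finFieldType) (x : F) :
  odd #|F| -> (qchar x)%:~R = x ^+ (#|F|./2) :> F.
Proof.
move=> oddF; rewrite /qchar; case: eqP => [->|/eqP x_neq0].
  by rewrite expr0n gtn_eqF // half_card_gt0.
case: eqP => [->|/eqP xm]; first by [].
by rewrite expf_half_card // rmorphN1.
Qed.

Lemma qcharM (F : finFieldType) (x y : F) :
  odd #|F| -> qchar (x * y) = qchar x * qchar y.
Proof.
move=> oddF; rewrite /qchar mulf_eq0 exprMn.
have [->|x_neq0] := eqVneq x 0; first by rewrite mul0r.
have [->|y_neq0] := eqVneq y 0; first by rewrite mulr0.
have [->|/(expf_half_card oddF x_neq0)->] := eqVneq (x ^+ _) 1; rewrite ?mul1r //=.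
have [->|/(expf_half_card oddF y_neq0)->] := eqVneq (y ^+ _) 1.
  by rewrite mulr1 eqN11_finField.
by rewrite mulrNN mulr1 eqxx.
Qed.

(** Scaling by a nonresidue changes the sign of the sum. *)
Lemma sum_qchar (F : finFieldType) : odd #|F| -> \sum_(x : F) qchar x = 0.
Proof.
move=> oddF; have [g g_neq0 gm] := nonresidue_finField oddF.
have qg : qchar g = -1 by rewrite /qchar (negPf g_neq0) (negPf gm).
have : \sum_(x : F) qchar x = - \sum_(x : F) qchar x.
  rewrite {1}(reindex_inj (mulfI g_neq0)) -mulN1r mulr_sumr.
  by apply: eq_bigr => x _; rewrite qcharM // qg.
lia.
Qed.

(** For d != 0, write k(k+d) = k^2 (1 + d/k) and substitute k -> d/k: what remains is the full
    character sum without its term at 1. *)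
Lemma sum_qchar_shift (F : finFieldType) (d : F) :
  odd #|F| ->
  \sum_(k : F) qchar k * qchar (k + d) = (if d == 0 then #|F|%:R else 0) - 1.
Proof.
move=> oddF; rewrite (bigD1 0) //= qchar0 mul0r add0r.
have [->|d_neq0] := eqVneq d 0.
  transitivity (\sum_(k : F | k != 0) (1 : int)).
    by apply: eq_bigr => k k_neq0; rewrite addr0 -expr2 sqr_qchar k_neq0.
  by rewrite sumr_const cardC1 -subn1 natrB // ltnW ?finNzRing_gt1.
(* Injective on all of F, since d / 0 = 0. *)
have inv_d : injective (fun k : F => d / k).
  by move=> x y /(mulfI d_neq0) /invr_inj.
transitivity (\sum_(k : F | k != 0) qchar (1 + k)).
  rewrite [RHS](reindex_inj inv_d) /=; apply: eq_big => [k|k k_neq0].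
    by rewrite mulf_eq0 invr_eq0 (negPf d_neq0).
  rewrite -qcharM // (_ : k * (k + d) = k * k * (1 + d / k)); last by field.
  by rewrite !qcharM // -expr2 sqr_qchar k_neq0 mul1r.
apply: (@addrI _ (qchar (1 + 0 : F))).
have := sum_qchar oddF; rewrite (reindex_inj (addrI (1 : F))) (bigD1 0) //= => ->.
by rewrite addr0 qchar1.
Qed.

(** For odd q = [#|F|], this is the number of affine points of y^2 = x^3 + k, minus q. *)
Definition cubic_sum (F : finFieldType) (k : F) : int :=
  \sum_(x : F) qchar (x ^+ 3 + k).

Lemma cubic_sum0 (F : finFieldType) : odd #|F| -> cubic_sum (0 : F) = 0.
Proof.
move=> oddF; rewrite -(sum_qchar oddF); apply: eq_bigr => x _.
rewrite addr0 exprS qcharM //.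
have [->|x_neq0] := eqVneq x 0; first by rewrite qchar0 mul0r.
by rewrite expr2 qcharM // -expr2 sqr_qchar x_neq0 mulr1.
Qed.

(** Substituting x -> tx pulls out t^3. Hence [qchar k * cubic_sum k] depends only on the class of k
    modulo nonzero cubes. *)
Lemma cubic_sum_twist (F : finFieldType) (k t : F) :
  odd #|F| -> t != 0 -> cubic_sum (k * t ^+ 3) = qchar t * cubic_sum k.
Proof.
move=> oddF t_neq0; rewrite /cubic_sum (reindex_inj (mulfI t_neq0)) mulr_sumr.
apply: eq_bigr => x _.
have -> : (t * x) ^+ 3 + k * t ^+ 3 = t * (t * t) * (x ^+ 3 + k) by ring.
by rewrite !qcharM // -expr2 sqr_qchar t_neq0 mulr1.
Qed.

(** After exchanging the sums, each x contributes -1, and x = 0 contributes q more; the total is q -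
    q. *)
Lemma sum_qchar_cubic_sum (F : finFieldType) :
  odd #|F| -> \sum_(k : F) qchar k * cubic_sum k = 0.
Proof.
move=> oddF; under eq_bigr => k _ do rewrite mulr_sumr.
rewrite exchange_big /=.
under eq_bigr => x _.
  under eq_bigr => k _ do rewrite addrC.
  rewrite sum_qchar_shift // expf_eq0 /=.
  over.
rewrite sumrB -big_mkcond /= big_pred1_eq sumr_const.
by rewrite subrr.
Qed.

Lemma cube_root_unity (F : finFieldType) :
  (3 %| #|F|.-1)%N -> exists2 w : F, w != 1 & w ^+ 2 + w + 1 = 0.
Proof.
move=> dvd3; have [g gP] := finField_prim_root F; exists (g ^+ (#|F|.-1 %/ 3)).
  rewrite -(prim_order_dvd gP); apply/negP => /dvdn_leq.
  move: dvd3 (prim_order_gt0 gP).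
  by case/dvdnP=> e ->; rewrite mulnK //; lia.
set w := g ^+ _; have w1 : w - 1 != 0.
  rewrite subr_eq0 -(prim_order_dvd gP); apply/negP => /dvdn_leq.
  move: dvd3 (prim_order_gt0 gP).
  by case/dvdnP=> e ->; rewrite mulnK //; lia.
apply: (mulfI w1); rewrite mulr0; transitivity (w ^+ 3 - 1); first by ring.
by rewrite -exprM divnK // prim_expr_order ?subrr.
Qed.

Lemma card_cube_eq (F : finFieldType) (y : F) :
  (3 %| #|F|.-1)%N -> y != 0 -> #|[pred x | x ^+ 3 == y ^+ 3]| = 3.
Proof.
move=> dvd3 y_neq0; have [w w1 ww] := cube_root_unity dvd3.
have w0 : w != 0.
  by apply/eqP => w0; move: ww; rewrite w0 expr0n /= !add0r => /eqP; rewrite oner_eq0.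
have w2 : w ^+ 2 = - w - 1 by apply/eqP; rewrite -subr_eq0; apply/eqP; rewrite -ww; ring.
have w3 : w * w ^+ 2 = 1.
  by rewrite w2 mulrBr mulr1 mulrN -expr2 w2; ring.
have uniqs : uniq [:: y; w * y; w ^+ 2 * y].
  rewrite /= !inE !negb_or andbT -andbA; apply/and3P; split.
  - by rewrite -[X in X == _]mul1r (inj_eq (mulIf y_neq0)) eq_sym.
  - rewrite -[X in X == _]mul1r (inj_eq (mulIf y_neq0)) eq_sym.
    by apply: contraNneq w1 => w21; rewrite -w3 w21 mulr1.
  - by rewrite (inj_eq (mulIf y_neq0)) expr2 -[X in X == _]mulr1
      (inj_eq (mulfI w0)) eq_sym.
transitivity #|[:: y; w * y; w ^+ 2 * y]|; last exact: (card_uniqP uniqs).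
apply: eq_card => x; rewrite !inE -subr_eq0.
have -> : x ^+ 3 - y ^+ 3 = (x - y) * ((x - w * y) * (x - w ^+ 2 * y)).
  transitivity ((x - y) *
    (x ^+ 2 - (w + w ^+ 2) * (x * y) + w * w ^+ 2 * y ^+ 2)); last by ring.
  by rewrite w3 w2; ring.
by rewrite !mulf_eq0 !subr_eq0.
Qed.

(** Expanding the square and summing over k first, each pair (x, y) contributes -1, plus q if x^3 =
    y^3. There are 1 + 3(q-1) such pairs, so the total is q(3q-2) - q^2. *)
Lemma sum_sqr_cubic_sum (F : finFieldType) :
  odd #|F| -> (3 %| #|F|.-1)%N ->
  \sum_(k : F) cubic_sum k ^+ 2 = (2 * #|F| * #|F|.-1)%:R.
Proof.
move=> oddF dvd3.
transitivity (\sum_(x : F) \sum_(y : F) \sum_(k : F)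
    qchar (x ^+ 3 + k) * qchar (y ^+ 3 + k)).
  transitivity (\sum_(k : F) \sum_(x : F) \sum_(y : F)
      qchar (x ^+ 3 + k) * qchar (y ^+ 3 + k)).
    apply: eq_bigr => k _; rewrite expr2 mulr_suml.
    by apply: eq_bigr => x _; rewrite mulr_sumr.
  rewrite exchange_big /=; apply: eq_bigr => x _; exact: exchange_big.
have sumk x y : \sum_(k : F) qchar (x ^+ 3 + k) * qchar (y ^+ 3 + k) =
    (if x ^+ 3 == y ^+ 3 then #|F|%:R else 0) - 1.
  rewrite (reindex_inj (addrI (- x ^+ 3))) /= eq_sym -subr_eq0 -sum_qchar_shift //.
  by apply: eq_bigr => k _; congr (_ * _); congr qchar; ring.
under eq_bigr => x _.
  under eq_bigr => y _ do rewrite sumk.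
  rewrite sumrB -big_mkcond /= !sumr_const.
  over.
have cube_eq0 : #|fun y : F => 0 ^+ 3 == y ^+ 3| = 1.
  rewrite -[RHS](card1 (0 : F)); apply: eq_card => y.
  by rewrite !inE unfold_in /= expr0n eq_sym expf_eq0.
have cube_eq x : x != 0 -> #|fun y : F => x ^+ 3 == y ^+ 3| = 3.
  move=> x_neq0; rewrite -[RHS](card_cube_eq dvd3 x_neq0).
  by apply: eq_card => y; rewrite !inE unfold_in /= eq_sym.
rewrite sumrB sumr_const (bigD1 0) //= cube_eq0.
rewrite (eq_bigr (fun=> #|F|%:R *+ 3)) => [|x x_neq0]; last by rewrite cube_eq.
rewrite sumr_const cardC1.
have := finNzRing_gt1 F; case: #|F| => // q _ /=.
nia.
Qed.

(* The average of G k, G (k g), G (k g^2) over k: such a triple always meets each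
   coset of the cubes once. *)
Lemma sum_cube_invariant (F : finFieldType) (g : F) (G : F -> int) :
  (#|F|.-1).-primitive_root g ->
  (forall k t, t != 0 -> G (k * t ^+ 3) = G k) ->
  3%:R * (\sum_(k : F | k != 0) G k) = #|F|.-1%:R * (G 1 + G g + G (g ^+ 2)).
Proof.
move=> gP invG.
have g_neq0 : g != 0 by rewrite (prim_root_eq0 gP) -lt0n (prim_order_gt0 gP).
have shift a : a != 0 -> \sum_(k : F | k != 0) G (k * a) = \sum_(k : F | k != 0) G k.
  move=> a_neq0; rewrite [RHS](reindex_inj (mulIf a_neq0)); apply: eq_bigl => k.
  by rewrite mulf_eq0 (negPf a_neq0) orbF.
transitivity (\sum_(k : F | k != 0) (G k + G (k * g) + G (k * g ^+ 2))).
  by rewrite !big_split /= !shift ?expf_neq0 //; ring.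
transitivity (\sum_(k : F | k != 0) (G 1 + G g + G (g ^+ 2))).
  apply: eq_bigr => k k_neq0.
  (* Write k = g^i with i = 3a + r. The cube g^(3a) drops out, and multiplication by g^r permutes
     the three values cyclically. *)
  have [i ->] := prim_rootP gP (expf_card_pred k_neq0).
  rewrite (divn_eq i 3) addnC exprD exprM; set t := g ^+ _ ^+ 3.
  have GM a : G (a * t) = G a by rewrite invG // !expf_neq0.
  rewrite !(mulrAC _ t) !GM.
  have Gg3 a : G (a * g ^+ 3) = G a by apply: invG.
  rewrite -exprD -exprSr.
  have := ltn_pmod i (isT : 0 < 3)%N; case: (i %% 3)%N => [|[|[|//]]] _.
  - by rewrite expr0 expr1.
  - by rewrite -(Gg3 1) mul1r expr1; ring.
  - rewrite -(Gg3 1) -(Gg3 g) mul1r -exprS; ring.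
by rewrite sumr_const cardC1 mulr_natl.
Qed.

Lemma cubic_sum_form (F : finFieldType) :
  odd #|F| -> (3 %| #|F|.-1)%N ->
  exists M : int, 4%:R * #|F|%:R = cubic_sum (1 : F) ^+ 2 + 3%:R * M ^+ 2.
Proof.
move=> oddF dvd3; have [g gP] := finField_prim_root F.
have g_neq0 : g != 0 by rewrite (prim_root_eq0 gP) -lt0n (prim_order_gt0 gP).
have q1_neq0 : #|F|.-1%:R != 0 :> int by rewrite pnatr_eq0 -lt0n (prim_order_gt0 gP).
pose s (k : F) := qchar k * cubic_sum k.
have s_inv k t : t != 0 -> s (k * t ^+ 3) = s k.
  move=> t_neq0; rewrite /s cubic_sum_twist // !qcharM //.
  have := sqr_qchar t; rewrite t_neq0 => t1.
  transitivity (qchar k * cubic_sum k * (qchar t ^+ 2) ^+ 2); first by ring.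
  by rewrite t1 expr1n mulr1.
have s2_inv k t : t != 0 -> s (k * t ^+ 3) ^+ 2 = s k ^+ 2 by move=> /s_inv->.
have := sum_cube_invariant gP s_inv; have := sum_cube_invariant gP s2_inv.
have -> : \sum_(k : F | k != 0) s k = 0.
  by have := sum_qchar_cubic_sum oddF; rewrite (bigD1 0) //= qchar0 mul0r add0r.
have -> : \sum_(k : F | k != 0) s k ^+ 2 = (2 * #|F| * #|F|.-1)%:R.
  rewrite -sum_sqr_cubic_sum // [RHS](bigD1 0) //= cubic_sum0 // expr0n add0r.
  by apply: eq_bigr => k k_neq0; rewrite exprMn sqr_qchar k_neq0 mul1r.
have -> : s 1 = cubic_sum (1 : F) by rewrite /s qchar1 mul1r.
move: (cubic_sum (1 : F)) (s g) (s (g ^+ 2)) => a b c sum2 sum1.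
have {}sum1 : a + b + c = 0.
  by apply: (mulfI q1_neq0); rewrite mulr0 -sum1 mulr0.
have {}sum2 : a ^+ 2 + b ^+ 2 + c ^+ 2 = 6%:R * #|F|%:R.
  by apply: (mulfI q1_neq0); rewrite -sum2 !natrM; ring.
(* From b + c = -a one gets (b-c)^2 = 2(b^2+c^2) - a^2 = 12q - 3a^2, so 3 divides b - c; the witness
   is M = (b-c)/3. *)
have sqr_bc : (b - c) ^+ 2 = 3%:R * (4%:R * #|F|%:R - a ^+ 2).
  transitivity (2%:R * (a ^+ 2 + b ^+ 2 + c ^+ 2) - 3%:R * a ^+ 2
    + (a - b - c) * (a + b + c)); first by ring.
  by rewrite sum1 sum2; ring.
have /dvdzP[M bc] : (3 %| b - c)%Z.
  have : (3 %| (b - c) ^+ 2)%Z by rewrite sqr_bc dvdz_mulr.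
  by rewrite !dvdzE abszX Euclid_dvdX // andbT.
exists M; apply: (mulfI (_ : 3%:R != 0)) => //.
by move: sqr_bc; rewrite bc exprMn; lia.
Qed.

(** Modulo 2 the sum counts the x with x^3 != -1; there are q - 3 of them, an even number. *)
Lemma cubic_sum1_mod2 (F : finFieldType) :
  odd #|F| -> (3 %| #|F|.-1)%N -> (2 %| cubic_sum (1 : F)%R)%Z.
Proof.
move=> oddF dvd3.
have qmod (x : F) : (2 %| (qchar x - (x != 0)%:R)%R)%Z.
  by rewrite /qchar; case: eqP => //= _; case: ifP.
have N1 : -1 != 0 :> F by rewrite oppr_eq0 oner_eq0.
have : (2 %| (\sum_(x : F) (qchar (x ^+ 3 + 1) - (x ^+ 3 + 1 != 0)%:R))%R)%Z.
  by apply: rpred_sum => x _; exact: qmod.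
rewrite sumrB.
have -> : \sum_(x : F) (x ^+ 3 + 1 != 0)%:R = #|F|%:R - 3%:R :> int.
  transitivity (\sum_(x : F) (1 - (x ^+ 3 == (-1) ^+ 3)%:R) : int).
    apply: eq_bigr => x _; have -> : (-1) ^+ 3 = -1 :> F by ring.
    by rewrite -addr_eq0; case: eqP.
  rewrite sumrB sumr_const -natr_sum; congr (_ - _%:R).
  rewrite -[RHS](card_cube_eq dvd3 N1) -sum1_card [RHS]big_mkcond /=.
  by apply: eq_bigr => x _; rewrite inE; case: eqP.
move=> dvdS.
have dvdq : (2 %| (#|F|%:R - 3%:R)%R)%Z.
  apply/dvdzP; exists (#|F|./2%:R - 1).
  by rewrite -{1}(odd_double_half #|F|) oddF; lia.
by have := rpredD dvdS dvdq; rewrite subrK.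
Qed.

(** The term x = 0 is 1; the others are grouped by y = x^3 into fibres of size 0 or 3. *)
Lemma cubic_sum1_mod3 (F : finFieldType) :
  (3 %| #|F|.-1)%N -> (3 %| (cubic_sum (1 : F) - 1)%R)%Z.
Proof.
move=> dvd3; rewrite /cubic_sum (bigD1 0) //= expr0n add0r qchar1 (addrC 1) addrK.
rewrite (partition_big (fun x => x ^+ 3) (fun y => y != 0)) /= => [|x]; last first.
  by rewrite expf_eq0.
apply: rpred_sum => y y_neq0.
rewrite (eq_bigr (fun=> qchar (y + 1))) => [|x /andP[_ /eqP->] //].
rewrite sumr_const; case: (pickP [pred x : F | x ^+ 3 == y]) => [w /= /eqP wy|ny].
  have w_neq0 : w != 0 by move: y_neq0; rewrite -wy expf_eq0.
  have -> : #|[pred x : F | x != 0 & x ^+ 3 == y]| = 3.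
    rewrite -[RHS](card_cube_eq dvd3 w_neq0); apply: eq_card => x; rewrite !inE wy.
    by case: (eqVneq x 0) => //= ->; rewrite expr0n eq_sym (negPf y_neq0).
  by apply/dvdzP; exists (qchar (y + 1)); lia.
rewrite (eq_card0 (_ : _ =i pred0)) ?mulr0n ?dvdz0 // => x.
by rewrite !inE unfold_in /= [x ^+ 3 == y]ny andbF.
Qed.

(** Since (Ab-aB)(Ab+aB) = p(b^2-B^2), p divides one factor. The identity p^2 = (Aa+3Bb)^2 +
    3(Ab-aB)^2, up to the sign of B, forces that factor to be 0. *)
Lemma sqr_add_3sqr_uniq (p : nat) (A B a b : int) :
  prime p -> p%:Z = A ^+ 2 + 3%:Z * B ^+ 2 -> p%:Z = a ^+ 2 + 3%:Z * b ^+ 2 ->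
  a = A \/ a = - A.
Proof.
move=> p_prime pAB pab; have p_gt0 : 0 < p%:Z by rewrite ltz_nat prime_gt0.
(* C stands for B or -B. *)
suff dvdB C : p%:Z = A ^+ 2 + 3%:Z * C ^+ 2 -> (p %| A * b - a * C)%Z -> a = A \/ a = - A.
  have : (p %| (A * b - a * B) * (A * b - a * - B))%Z.
    apply/dvdzP; exists (b ^+ 2 - B ^+ 2).
    transitivity ((A ^+ 2 + 3%:Z * B ^+ 2) * b ^+ 2 - (a ^+ 2 + 3%:Z * b ^+ 2) * B ^+ 2).
      by ring.
    by rewrite -pAB -pab; ring.
  rewrite dvdzE abszM Euclid_dvdM // => /orP[|]; first exact: dvdB.
  by apply: dvdB; rewrite sqrrN.
move=> pAC /dvdzP[t tE].
have p2 : p%:Z ^+ 2 = (A * a + 3%:Z * C * b) ^+ 2 + 3%:Z * (t * p%:Z) ^+ 2.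
  rewrite -tE expr2 {1}pAC pab; ring.
have t0 : t = 0.
  apply/eqP/contraT => t_neq0.
  have t2 : 1 <= t ^+ 2 by rewrite -gtz0_ge1 exprn_even_gt0.
  have p2_gt0 : 0 < p%:Z ^+ 2 by rewrite exprn_gt0.
  have := ler_peMl (ltW p2_gt0) t2; have := sqr_ge0 (A * a + 3%:Z * C * b).
  rewrite exprMn in p2; move: p2 p2_gt0.
  move: (p%:Z ^+ 2) ((_ + _) ^+ 2) => P X; move: (t ^+ 2 * P) => Y.
  by clear; lia.
have Ab : A * b = a * C by apply/eqP; rewrite -subr_eq0 tE t0 mul0r.
have : p%:Z * b ^+ 2 = p%:Z * C ^+ 2.
  transitivity ((A * b) ^+ 2 + 3%:Z * (C * b) ^+ 2); first by rewrite pAC; ring.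
  by rewrite Ab pab; ring.
move/(mulfI (lt0r_neq0 p_gt0)) => bC.
have /eqP : a ^+ 2 = A ^+ 2 by move: pAC; rewrite pab bC => /addIr.
by rewrite eqf_sqr => /orP[] /eqP ->; [left | right].
Qed.

(** The sum s and M are both even; halving gives p = a^2 + 3b^2 with s = 2a, so a = A or a = -A. As
    s = 1 mod 3, a = -1 mod 3, which selects -A. *)
Lemma cubic_sum1_value (p : nat) (F : finFieldType) (A B : int) :
  prime p -> #|F| = p -> odd p -> (3 %| p.-1)%N ->
  p%:Z = A ^+ 2 + 3%:Z * B ^+ 2 -> (3 %| A - 1)%Z ->
  cubic_sum (1 : F) = - (2%:R * A).
Proof.
move=> p_prime cardF oddp dvd3 pAB /dvdzP[c Ac].
have oddF : odd #|F| by rewrite cardF.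
have dvdF : (3 %| #|F|.-1)%N by rewrite cardF.
have [M] := cubic_sum_form oddF dvdF.
have /dvdzP[a] := cubic_sum1_mod2 oddF dvdF; have /dvdzP[d] := cubic_sum1_mod3 dvdF.
rewrite cardF; move: (cubic_sum _) => s sd sa pM.
have [b Mb] : exists b, M = 2%:R * b.
  have /dvdzP[b Mb] : (2 %| M)%Z.
    have : (2 %| 3%:R * M ^+ 2)%Z.
      apply/dvdzP; exists (2%:R * p%:R - 2%:R * a ^+ 2).
      by rewrite -[LHS](addKr (s ^+ 2)) -pM sa; ring.
    by rewrite Gauss_dvdzr // !dvdzE abszX Euclid_dvdX // andbT.
  by exists b; rewrite Mb mulrC.
have pab : p%:Z = a ^+ 2 + 3%:Z * b ^+ 2.
  apply: (mulfI (_ : 4%:R != 0)) => //.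
  by rewrite -[p%:Z]natz pM sa Mb; ring.
by case: (sqr_add_3sqr_uniq p_prime pAB pab) => aA; move: sd sa Ac aA; clear; lia.
Qed.

(** -3 = (2w+1)^2 for a primitive cube root of unity w. *)
Lemma expfN3_half (F : finFieldType) :
  odd #|F| -> (3 %| #|F|.-1)%N -> 3%:R != 0 :> F -> (- 3%:R) ^+ (#|F|./2) = 1 :> F.
Proof.
move=> oddF dvd3 three_neq0; have [w _ ww] := cube_root_unity dvd3.
have sqrN3 : (2%:R * w + 1) ^+ 2 = - 3%:R.
  by transitivity (4%:R * (w ^+ 2 + w + 1) - 3%:R); [ring | rewrite ww mulr0 sub0r].
rewrite -sqrN3 -exprM mulnC -card_pred_half // expf_card_pred //.
by rewrite -sqrf_eq0 sqrN3 oppr_eq0.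
Qed.

(** The power sum is the cubic sum at -1, that is (-1)^m times -2A; the remaining factor (-1)^m 3^m
    = (-3)^m is 1. *)
Lemma trinomial_value_split (p m : nat) (F : finFieldType) (u v : F) (A B : int) :
  prime p -> p \in [pchar F] -> #|F| = p -> p = m.*2.+1 ->
  4%:R * u = 1 -> 3%:R * v = 1 -> (3 %| p.-1)%N ->
  p%:Z = A ^+ 2 + 3%:Z * B ^+ 2 -> (3 %| A - 1)%Z ->
  (trinomial_poly u m).[4%:R * v] = (2%:R * A)%:~R.
Proof.
move=> p_prime charFp cardF pm u4 v3 dvd3 pAB A1.
have oddp : odd p by rewrite pm /= odd_double.
have oddF : odd #|F| by rewrite cardF.
have mE : m = #|F|./2 by rewrite cardF pm /= uphalf_double.
have three_neq0 : 3%:R != 0 :> F.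
  by apply/eqP => three0; move/eqP: v3; rewrite three0 mul0r eq_sym oner_eq0.
have := trinomial_power_sum charFp cardF pm u4 v3.
have -> : \sum_(x : F) (x ^+ 3 - 1) ^+ m = (cubic_sum (-1 : F))%:~R.
  by rewrite /cubic_sum rmorph_sum; apply: eq_bigr => x _; rewrite /= intr_qchar // mE.
have -> : -1 = 1 * (-1) ^+ 3 :> F by ring.
rewrite cubic_sum_twist ?oppr_eq0 ?oner_eq0 //.
rewrite (cubic_sum1_value p_prime cardF oddp dvd3 pAB A1) intrM intr_qchar // -mE => T.
have N3m : (-1) ^+ m * 3%:R ^+ m = 1 :> F.
  by rewrite -exprMn mulN1r mE expfN3_half // cardF.
transitivity ((-1) ^+ m * (3%:R ^+ m * (trinomial_poly u m).[4%:R * v])).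
  by rewrite mulrA N3m mul1r.
rewrite T mulrN mulrA -exprMn mulrNN mulr1 expr1n mul1r.
by rewrite -rmorphN opprK.
Qed.

Lemma trinomial_value_inert (p m : nat) (F : finFieldType) (u v : F) :
  p \in [pchar F] -> #|F| = p -> p = m.*2.+1 ->
  4%:R * u = 1 -> 3%:R * v = 1 -> (p %% 3 = 2)%N ->
  (trinomial_poly u m).[4%:R * v] = 0.
Proof.
move=> charFp cardF pm u4 v3 p3.
have three_neq0 : 3%:R != 0 :> F.
  by apply/eqP => three0; move/eqP: v3; rewrite three0 mul0r eq_sym oner_eq0.
apply: (mulfI (expf_neq0 m three_neq0)); rewrite mulr0.
rewrite (trinomial_power_sum charFp cardF pm u4 v3).
(* The inverse exponent is (2p-1)/3, as 2p - 1 = (p-1) + p. *)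
have cubeK : cancel (fun x : F => x ^+ 3) (fun x => x ^+ (p %/ 3).*2.+1).
  move=> x; rewrite -exprM (_ : 3 * _ = p.-1 + p)%N; last by lia.
  have [->|x_neq0] := eqVneq x 0; first by rewrite expr0n pm addnS.
  by rewrite exprD -cardF expf_card expf_card_pred // mul1r.
transitivity (- \sum_(x : F) (x - 1) ^+ m).
  by rewrite [in RHS](reindex_inj (can_inj cubeK)).
rewrite (reindex_inj (addIr (1 : F))) /=; under eq_bigr => x _ do rewrite addrK.
rewrite sum_expr_finField ?oppr0 //.
have m_gt0 : (0 < m)%N by have := finNzRing_gt1 F; rewrite cardF pm; case: (m).
by rewrite cardF pm /= gtnNdvd //; lia.
Qed.

(** * Evaluation at 4/3 and transfer to the rationals *)

(** In F, 8[p/8] = -(p mod 8) and 8[3p/8] = -(3p mod 8). So the parameters are 1/8, 3/8 when p = 1,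
    3 mod 8 and 5/8, 7/8 when p = 5, 7 mod 8. At x = 4/3, 4x(1-x) = -16/9 and 1 - 2x = -5/3. *)
Lemma bin2_poly_value (p : nat) (F : fieldType) (u v : F) :
  prime p -> p \in [pchar F] -> (7 < p)%N -> 4%:R * u = 1 -> 3%:R * v = 1 ->
  (if (p %% 8 == 1)%N || (p %% 8 == 3)%N then 1 else - (5%:R * v)) *
    (bin2_poly F (p %/ 8) (3 * p %/ 8)).[- (16%:R * v ^+ 2)] =
  (trinomial_poly u p./2).[4%:R * v].
Proof.
move=> p_prime charFp p7 u4 v3.
have oddp : odd p by apply/contraT => /(prime_oddPn p_prime) p2; rewrite p2 in p7.
have pm : p = (p./2).*2.+1 by rewrite -[LHS](odd_double_half p) oddp.
have mp : (p./2 < p)%N by rewrite [X in (_ < X)%N]pm ltnS -addnn leq_addl.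
have two_neq0 : 2%:R != 0 :> F.
  by rewrite -(dvdn_pcharf charFp) gtnNdvd // (ltn_trans _ p7).
have nat_eq (a b c : nat) : (a + b = c * p)%N -> a%:R = - b%:R :> F.
  move=> abc; apply/eqP; rewrite -addr_eq0 -natrD abc natrM.
  by rewrite (pcharf0 charFp) mulr0.
have mu : (p./2)%:R = - (2%:R * u) :> F.
  apply: (mulfI two_neq0); rewrite mulrN mulrA -!natrM u4 mul2n.
  by apply: (nat_eq _ 1%N 1%N); rewrite addn1 -pm mul1n.
have zE : 4%:R * (4%:R * v * (1 - 4%:R * v)) = - (16%:R * v ^+ 2).
  by transitivity (4%:R * (4%:R * v * (3%:R * v - 4%:R * v))); [rewrite v3 | ring].
have xE : 1 - 2%:R * (4%:R * v) = - (5%:R * v).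
  by transitivity (3%:R * v - 2%:R * (4%:R * v)); [rewrite v3 | ring].
have eight_neq0 : 8%:R != 0 :> F by rewrite (natrX _ 2 3) expf_neq0.
have u8 : 8%:R * u = 2%:R by rewrite (natrM _ 2 4) -mulrA u4 mulr1.
have n1E : (8 * (p %/ 8))%:R = - (p %% 8)%:R :> F.
  by apply: (nat_eq _ _ 1); rewrite mulnC -divn_eq mul1n.
have n2E : (8 * (3 * p %/ 8))%:R = - ((3 * p) %% 8)%:R :> F.
  by apply: (nat_eq _ _ 3); rewrite mulnC -divn_eq.
have sumE : 8%:R * (2%:R * ((p %/ 8)%:R + (3 * p %/ 8)%:R))
    = - (2 * (p %% 8 + (3 * p) %% 8))%:R :> F.
  by rewrite mulrCA mulrDr -!natrM n1E n2E -opprD -natrD mulrN -natrM.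
have prodE : 8%:R * (8%:R * (4%:R * ((p %/ 8)%:R * (3 * p %/ 8)%:R)))
    = (4 * (p %% 8 * ((3 * p) %% 8)))%:R :> F.
  transitivity (4%:R * ((8 * (p %/ 8))%:R * (8 * (3 * p %/ 8))%:R) : F).
    by rewrite !natrM; ring.
  by rewrite n1E n2E mulrNN -!natrM.
have u2E : 8%:R * (8%:R * (3%:R * u ^+ 2)) = 12%:R :> F.
  transitivity (3%:R * (8%:R * u) ^+ 2 : F); first by ring.
  by rewrite u8 -natrX -natrM.
have p8 : (p %% 8 \in [:: 1; 3; 5; 7])%N.
  have : odd (p %% 8) by rewrite odd_mod.
  have := ltn_pmod p (isT : 0 < 8)%N.
  by case: (p %% 8)%N => [|[|[|[|[|[|[|[|k]]]]]]]].
have p38 : (3 * p %% 8 = 3 * (p %% 8) %% 8)%N by rewrite modnMmr.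
have n1p : ((p %/ 8).*2.+1 < p)%N by move: p7; clear; lia.
rewrite p38 in sumE prodE; rewrite -zE.
case: ifP => p8E.
  rewrite mul1r; apply: (bin2_trinomial_even _ charFp (ltnW n1p) mp u4 mu).
    apply: (mulfI eight_neq0); rewrite sumE mulrN1.
    by case/orP: p8E => /eqP->.
  apply: (mulfI eight_neq0); apply: (mulfI eight_neq0); rewrite prodE u2E.
  by case/orP: p8E => /eqP->.
rewrite -xE; apply: (bin2_trinomial_odd _ charFp n1p mp u4 mu).
  apply: (mulfI eight_neq0); rewrite sumE mulrN -natrM.
  by move: p8 p8E; rewrite !inE => /or4P[] /eqP->.
apply: (mulfI eight_neq0); apply: (mulfI eight_neq0).
rewrite 2!mulrBr prodE u2E -!natrM.
by move: p8 p8E; rewrite !inE => /or4P[] /eqP-> // _; rewrite -natrB.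
Qed.

(** The reduced denominators divide b and d, and the numerator of the difference times bd is a
    multiple of ad - cb, with bd coprime to p. *)
Lemma rat_eqmod_frac (p : nat) (a b c d : int) :
  prime p -> coprimez p b -> coprimez p d -> (p %| a * d - c * b)%Z ->
  rat_eqmod p (a%:~R / b%:~R) (c%:~R / d%:~R).
Proof.
move=> p_prime pb pd dvd_p.
have neq0 n : coprimez p n -> n != 0.
  move=> pn; apply/eqP => n0; move: pn (prime_gt1 p_prime).
  by rewrite n0 /coprimez gcdz0 => /eqP; lia.
have dvd_den (n m : int) : m != 0 -> (denq (n%:~R / m%:~R) %| m)%Z.
  move=> m_neq0; have dq := denq_neq0 (n%:~R / m%:~R).
  have : (numq (n%:~R / m%:~R) * m)%:~R = (n * denq (n%:~R / m%:~R))%:~R :> rat.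
    by rewrite !intrM numqE; field; rewrite intr_eq0.
  move/intr_inj => e.
  have cop : coprimez (denq (n%:~R / m%:~R)) (numq (n%:~R / m%:~R)).
    by rewrite coprimez_sym; exact: coprime_num_den.
  by rewrite -(Gauss_dvdzr _ cop) e dvdz_mull.
split.
- exact: coprimez_dvdr (dvd_den _ _ (neq0 _ pb)) pb.
- exact: coprimez_dvdr (dvd_den _ _ (neq0 _ pd)) pd.
have pbd : coprimez p (b * d) by rewrite coprimezMr pb.
rewrite -(Gauss_dvdzl _ pbd).
have -> : numq (a%:~R / b%:~R - c%:~R / d%:~R) * (b * d) =
    (a * d - c * b) * denq (a%:~R / b%:~R - c%:~R / d%:~R).
  apply: (@intr_inj rat); rewrite !intrM numqE rmorphB /= !intrM.
  by field; rewrite !intr_eq0 !neq0.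
exact: dvdz_mulr.
Qed.

(** The value at -16/9 with denominators cleared by 9^n1: an integer that maps both to the rationals
    and to F. *)
Definition bin2_numerator (n1 n2 : nat) : int :=
  \sum_(k < n1.+1) ('C(n1, k) * 'C(n2, k))%:Z * (- 16%:Z) ^+ k * 9%:Z ^+ (n1 - k).

Lemma horner_bin2_poly (K : fieldType) (n1 n2 : nat) (v : K) :
  3%:R * v = 1 ->
  (bin2_numerator n1 n2)%:~R = 9%:R ^+ n1 * (bin2_poly K n1 n2).[- (16%:R * v ^+ 2)].
Proof.
move=> v3; rewrite /bin2_numerator rmorph_sum horner_poly mulr_sumr.
apply: eq_bigr => k _ /=.
have -> : 9%:R ^+ n1 = 9%:R ^+ (n1 - k) * 9%:R ^+ k :> K.
  by rewrite -exprD subnK // -ltnS.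
have -> : - (16%:R * v ^+ 2) = - 16%:R * v ^+ 2 by rewrite mulNr.
have v9 : 9%:R ^+ k * (v ^+ 2) ^+ k = 1 :> K.
  by rewrite -exprMn (natrX _ 3 2) -exprMn v3 !expr1n.
rewrite !intrM !rmorphXn /= rmorphN /= -!pmulrn natrM exprMn.
by transitivity ('C(n1, k)%:R * 'C(n2, k)%:R * (- 16%:R) ^+ k * 9%:R ^+ (n1 - k)
  * (9%:R ^+ k * (v ^+ 2) ^+ k)); [rewrite v9 mulr1 | ring].
Qed.

(** The rational sum has denominator 9^n1, prime to p since 3 is invertible in F; the
    cross-multiplied difference vanishes in F. *)
Lemma bin2_sum_rat_eqmod (p n1 n2 : nat) (F : fieldType) (v : F) (c d : int) :
  prime p -> p \in [pchar F] -> 3%:R * v = 1 -> coprimez p d ->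
  (bin2_poly F n1 n2).[- (16%:R * v ^+ 2)] * d%:~R = c%:~R ->
  rat_eqmod p (\sum_(0 <= k < n1.+1)
    'C(n1, k)%:R * 'C(n2, k)%:R * (- (16%:R / 9%:R)) ^+ k) (c%:~R / d%:~R).
Proof.
move=> p_prime charFp v3 pd valF.
have nine_neq0 : 9%:R ^+ n1 != 0 :> rat by rewrite expf_neq0.
have -> : \sum_(0 <= k < n1.+1) 'C(n1, k)%:R * 'C(n2, k)%:R * (- (16%:R / 9%:R)) ^+ k
    = (bin2_numerator n1 n2)%:~R / (9%:Z ^+ n1)%:~R :> rat.
  have v3rat : 3%:R * 3%:R^-1 = 1 :> rat by [].
  rewrite big_mkord (horner_bin2_poly n1 n2 v3rat) rmorphXn /= [RHS]mulrC mulKf //.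
  by rewrite horner_poly.
have p3 : coprimez p 9%:Z.
  change (coprime p (3 ^ 2)); rewrite coprimeXr // prime_coprime //.
  rewrite (dvdn_pcharf charFp); apply/eqP => three0; move/eqP: v3.
  by rewrite three0 mul0r eq_sym oner_eq0.
apply: rat_eqmod_frac => //; first by rewrite coprimezXr.
rewrite (dvdz_pcharf charFp) rmorphB /= !intrM (horner_bin2_poly n1 n2 v3).
by rewrite rmorphXn /= -mulrA valF mulrC subrr.
Qed.

Theorem theorem5p13 (p : nat) (p_prime : prime p) (p_gt7 : (7 < p)%N) :
  let S : rat :=
    \sum_(0 <= k < (p %/ 8).+1)
      'C(p %/ 8, k)%:R * 'C(3 * p %/ 8, k)%:R * (- (16%:R / 9%:R)) ^+ k in
  [/\ forall A B : int,
        p%:Z = A ^+ 2 + 3%:Z * B ^+ 2 ->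
        (p = 1 %[mod 24])%N \/ (p = 19 %[mod 24])%N ->
        (3 %| A - 1)%Z ->
        rat_eqmod p S (2%:R * A%:~R),
      forall A B : int,
        p%:Z = A ^+ 2 + 3%:Z * B ^+ 2 ->
        (p = 7 %[mod 24])%N \/ (p = 13 %[mod 24])%N ->
        (3 %| A - 1)%Z ->
        rat_eqmod p S (- (6%:R / 5%:R) * A%:~R)
    & (p = 2 %[mod 3])%N -> rat_eqmod p S 0].
Proof.
move=> S.
pose F : finFieldType := 'F_p.
have charFp : p \in [pchar F] := pchar_Fp p_prime.
have cardF : #|F| = p := card_Fp p_prime.
have oddp : odd p by apply/contraT => /(prime_oddPn p_prime) p2; rewrite p2 in p_gt7.
have pm : p = (p./2).*2.+1 by rewrite -[LHS](odd_double_half p) oddp.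
have nat_neq0 n : (0 < n)%N -> (n < p)%N -> n%:R != 0 :> F.
  by move=> n_gt0 np; rewrite -(dvdn_pcharf charFp) gtnNdvd.
have two_neq0 : 2%:R != 0 :> F by apply: nat_neq0 => //; apply: ltn_trans p_gt7.
have five_neq0 : 5%:R != 0 :> F by apply: nat_neq0 => //; apply: ltn_trans p_gt7.
have three_neq0 : 3%:R != 0 :> F by apply: nat_neq0 => //; apply: ltn_trans p_gt7.
have u4 : 4%:R * 4%:R^-1 = 1 :> F by rewrite mulfV // (natrX _ 2 2) expf_neq0.
have v3 : 3%:R * 3%:R^-1 = 1 :> F by rewrite mulfV.
have value := bin2_poly_value p_prime charFp p_gt7 u4 v3.
split=> [A B pAB p24 A1|A B pAB p24 A1|p3].
(* Here p = 1 or 3 mod 8 and p = 1 mod 3, so the prefactor is 1. *)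
- have -> : 2%:R * A%:~R = (2%:R * A)%:~R / 1%:~R :> rat by rewrite intrM divr1.
  apply: (bin2_sum_rat_eqmod p_prime charFp v3); first exact: coprimen1.
  rewrite mulr1 -(trinomial_value_split p_prime charFp cardF pm u4 v3 _ pAB A1).
    rewrite -value ifT ?mul1r //; by case: p24; clear; lia.
  by case: p24; clear; lia.
- have -> : - (6%:R / 5%:R) * A%:~R = (- (6%:R * A))%:~R / 5%:~R :> rat.
    by rewrite rmorphN /= intrM; field.
  apply: (bin2_sum_rat_eqmod p_prime charFp v3).
    by change (coprime p 5); rewrite prime_coprime // (dvdn_pcharf charFp).
  have := trinomial_value_split p_prime charFp cardF pm u4 v3 _ pAB A1.
  rewrite -value ifF => [T|]; last by case: p24; clear; lia.
  (* Here p = 5 or 7 mod 8, and -(5/3) P = 2A becomes 5P = -6A. *)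
  transitivity (- 3%:R * (2%:R * A)%:~R : F); last by rewrite rmorphN /= !intrM; ring.
  rewrite -T; last by case: p24; clear; lia.
  move: (_.[_]) => P; transitivity (P * 5%:~R * (3%:R * 3%:R^-1)); last by ring.
  by rewrite v3 mulr1.
- have -> : 0 = 0%:~R / 1%:~R :> rat by rewrite mul0r.
  apply: (bin2_sum_rat_eqmod p_prime charFp v3); first exact: coprimen1.
  have := trinomial_value_inert charFp cardF pm u4 v3 p3.
  (* The prefactor 1 or -5/3 is nonzero in F, so the polynomial value itself vanishes. *)
  rewrite -value mulr1 => /eqP; rewrite mulf_eq0 => /orP[|/eqP->//].
  case: ifP => _; first by rewrite oner_eq0.
  by rewrite oppr_eq0 mulf_eq0 invr_eq0 (negPf five_neq0) (negPf three_neq0).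
Qed.
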